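(* Let $n$ be a positive integer. Then $r_1(D_{2n})$ is equal to the number of abelian subgroups of $D_{2n}$, and $r_1(Dic_n)$ is equal to the number of abelian subgroups of $Dic_n$.
   Context: $D_{2n}=\langle a,b \mid a^n=b^2=1,\ bab^{-1}=a^{-1}\rangle$ is the dihedral group of order $2n$, and $Dic_n=\langle a,x\mid a^{2n}=1,\ x^2=a^n,\ xax^{-1}=a^{-1}\rangle$ is the dicyclic group of order $4n$. For a finite group $G$, let $G(1)=\{(g,k)\in G\times G : [k,g]=1\}$ be the set of commuting pairs. Consider the graph with vertex set $G(1)$ whose edges are given by the identifications $(g,k)\sim(g,kg^m)$ for $m\in\mathbb{Z}$, and $(g,k)\sim(gkg^{-1},g^{-1})=(k,g^{-1})$. The number $r_1(G)$ is the number of connected components of this graph. *)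

(* Defs.v *)
From HB Require Import structures.
From mathcomp Require Import all_boot all_order all_algebra all_fingroup.

Set Implicit Arguments.
Unset Strict Implicit.
Unset Printing Implicit Defensive.

Import GRing.Theory.

Local Open Scope group_scope.

(* G \isog Grp (...) says that G is the largest finite group with the given   *)
(* presentation, hence the presented group itself as that is finite; all n > 0 *)
(* are covered, including the degenerate dihedral groups of order 2 and 4 and *)
(* the cyclic dicyclic group of order 4. The facts dihedral_exists and        *)
(* dicyclic_exists below show that such groups exist, with the usual orders.  *)
Definition is_dihedral (n : nat) (gT : finGroupType) (G : {group gT}) : Prop :=
  G \isog Grp (a : b : a ^+ n, b ^+ 2, b * a * b^-1 = a^-1).

Definition is_dicyclic (n : nat) (gT : finGroupType) (G : {group gT}) : Prop :=
  G \isog Grp (a : x : a ^+ (2 * n), x ^+ 2 = a ^+ n, x * a * x^-1 = a^-1).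

Definition commuting_pairs (gT : finGroupType) (G : {group gT}) :
    {set gT * gT} :=
  [set u in setX G G | [~ u.2, u.1] == 1].

(* k * g ^ m, m ranging over the integers, describes the coset k *: <[g]>;    *)
(* see twist_moveP.                                                           *)
Definition twist_move (gT : finGroupType) : rel (gT * gT) :=
  fun u v => (v.1 == u.1) && (v.2 \in u.2 *: <[u.1]>).

Definition swap_move (gT : finGroupType) : rel (gT * gT) :=
  fun u v => v == (u.1 * u.2 * u.1^-1, u.1^-1).

Definition r1_edge (gT : finGroupType) (G : {group gT}) : rel (gT * gT) :=
  fun u v =>
    [&& u \in commuting_pairs G, v \in commuting_pairs G
      & [|| twist_move u v, twist_move v u, swap_move u v | swap_move v u]].

(* n_comp counts connected components only for a symmetric relation and a     *)
(* closed vertex set; see r1_connect_sym and r1_closed.                       *)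
Definition r1 (gT : finGroupType) (G : {group gT}) : nat :=
  n_comp (r1_edge G) (commuting_pairs G).

Lemma twist_moveP (gT : finGroupType) (g k : gT) (v : gT * gT) :
  reflect (exists m : nat, v = (g, k * g ^+ m) \/ v = (g, k * g ^- m))
          (twist_move (g, k) v).
Proof.
case: v => h l; rewrite /twist_move /=; apply: (iffP andP).
  by case=> /eqP-> /lcosetP[_ /cycleP[m ->] ->]; exists m; left.
case=> m [] [-> ->]; split=> //; apply/lcosetP.
  by exists (g ^+ m) => //; rewrite mem_cycle.
by exists (g ^- m) => //; rewrite groupV mem_cycle.
Qed.

Lemma swap_move_commuting (gT : finGroupType) (G : {group gT}) (g k : gT) :
  (g, k) \in commuting_pairs G ->
  (g * k * g^-1, g^-1) = (k, g^-1) /\ (k, g^-1) \in commuting_pairs G.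
Proof.
rewrite !inE /= => /andP[/andP[Gg Gk] /commgP/= cgk].
split; first by rewrite -cgk mulgK.
by rewrite Gk groupV Gg; apply/commgP/commute_sym/commuteV.
Qed.

Lemma r1_edge_sym (gT : finGroupType) (G : {group gT}) : symmetric (r1_edge G).
Proof.
move=> u v; rewrite /r1_edge andbCA orbCA; do 2!congr (_ && _).
by do 2!congr (_ || _); rewrite orbC.
Qed.

Lemma r1_connect_sym (gT : finGroupType) (G : {group gT}) :
  connect_sym (r1_edge G).
Proof. exact/sym_connect_sym/r1_edge_sym. Qed.

Lemma r1_closed (gT : finGroupType) (G : {group gT}) :
  fingraph.closed (r1_edge G) (mem (commuting_pairs G)).
Proof. by move=> u v /and3P[Gu Gv _]; rewrite /= Gu Gv. Qed.

(* Uniform model of both families: an extension of Z/2 by the integers mod    *)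
(* m.+1, acting by inversion, in which the square of the lift (0, true) of    *)
(* the generator of Z/2 is the element c, which has order at most 2.          *)
Definition inv_ext (m : nat) (c : 'I_m.+1) (c2 : (c + c = 0)%R) : Type :=
  ('I_m.+1 * bool)%type.

HB.instance Definition _ m c c2 := Finite.on (@inv_ext m c c2).

Section InvExt.
Local Open Scope ring_scope.
Variables (m : nat) (c : 'I_m.+1) (c2 : c + c = 0).
Local Notation T := (inv_ext c2).

Definition inv_ext_mul (u v : T) : T :=
  (u.1 + (if u.2 then - v.1 else v.1) + (if u.2 && v.2 then c else 0),
   u.2 (+) v.2).
Definition inv_ext_one : T := (0, false).
Definition inv_ext_inv (u : T) : T :=
  (if u.2 then u.1 + c else - u.1, u.2).

Lemma inv_ext_mulA : associative inv_ext_mul.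
Proof.
have Nc : - c = c by apply/eqP; rewrite eq_sym -addr_eq0 c2.
move=> [i []] [j []] [k []]; rewrite /inv_ext_mul /=; congr (_, _);
  rewrite ?addr0 ?opprD ?opprK ?Nc ?addrA //.
- by rewrite [RHS]addrAC.
- by rewrite [RHS]addrAC.
Qed.

Lemma inv_ext_mul1 : left_id inv_ext_one inv_ext_mul.
Proof. by case=> i b; rewrite /inv_ext_mul /= addr0 add0r. Qed.

Lemma inv_ext_mulV : left_inverse inv_ext_one inv_ext_inv inv_ext_mul.
Proof.
case=> i []; rewrite /inv_ext_mul /inv_ext_one /=; last by rewrite addr0 addNr.
by rewrite [i + c]addrC addrK c2.
Qed.

HB.instance Definition _ :=
  Finite_isGroup.Build T inv_ext_mulA inv_ext_mul1 inv_ext_mulV.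

Local Open Scope group_scope.

Lemma inv_ext_mulE (u v : T) : u * v = inv_ext_mul u v.
Proof. by []. Qed.

Lemma inv_ext_pow k : ((inord 1, false) : T) ^+ k = (inZp k, false).
Proof.
elim: k => [|k IHk]; first by congr (_, _); apply/val_inj; rewrite /= mod0n.
rewrite expgS IHk inv_ext_mulE /inv_ext_mul /= addr0; congr (_, _).
apply/val_inj=> /=; rewrite modnDmr; case: (m) => [|m']; first by rewrite !modn1.
by rewrite inordK.
Qed.

Lemma card_inv_ext : #|[set: T]| = (2 * m.+1)%N.
Proof. by rewrite cardsT card_prod card_ord card_bool mulnC. Qed.

Lemma inv_ext_hom :
  [set: T] \homg Grp (a : b : a ^+ m.+1, b ^+ 2 = a ^+ c, b * a * b^-1 = a^-1).
Proof.
set a : T := (inord 1, false); set b : T := (0%R, true).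
apply/existsP; exists (a, b); apply/eqP; congr (_, (_, (_, _))) => /=.
- apply/eqP; rewrite eqEsubset subsetT; apply/subsetP=> [[i d]] _.
  have -> : ((i, d) : T) = a ^+ i * (if d then b else 1).
    rewrite inv_ext_pow inv_ext_mulE /inv_ext_mul valZpK.
    by case: d; rewrite /= !addr0.
  have [Ga Gb] : a \in <[a]> <*> <[b]> /\ b \in <[a]> <*> <[b]>.
    by rewrite !mem_gen // inE cycle_id ?orbT.
  by rewrite groupM ?groupX //; case: d.
- by rewrite inv_ext_pow; congr (_, _); apply/val_inj; rewrite /= modnn.
- by rewrite inv_ext_pow valZpK -[b ^+ 2]/(inv_ext_mul b b) /inv_ext_mul /=
    oppr0 !add0r.
- apply: (mulIg b); rewrite mulgKV.
  rewrite -[b * a]/(inv_ext_mul b a) -[a^-1 * b]/(inv_ext_mul a^-1 b).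
  by rewrite /inv_ext_mul /= !addr0 add0r.
Qed.

Lemma inv_ext_Grp :
  [set: T] \isog Grp (a : b : a ^+ m.+1, b ^+ 2 = a ^+ c, b * a * b^-1 = a^-1).
Proof.
apply: intro_isoGrp inv_ext_hom _ => gT H /existsP[[x y]] /= /eqP[defH xm y2 xy].
pose f (u : T) := x ^+ u.1 * (if u.2 then y else 1).
have xN (i : 'I_m.+1) : x ^+ (- i)%R = x ^- i.
  apply/eqP; rewrite eq_sym eq_invg_mul -expgD -(expg_mod _ xm).
  have /(congr1 val) /= -> := addrN i.
  by rewrite expg0.
have xD (i j : 'I_m.+1) : x ^+ (i + j)%R = x ^+ i * x ^+ j.
  by rewrite /= (expg_mod _ xm) expgD.
have yx i : y * x ^+ i = x ^- i * y.
  elim: i => [|i IHi]; first by rewrite invg1 mulg1 mul1g.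
  have yx1 : y * x = x^-1 * y by rewrite -xy mulgKV.
  by rewrite expgSr mulgA IHi -mulgA yx1 mulgA -invMg -expgS expgSr.
have fM : {in [set: T] &, {morph f : u v / u * v}}.
  case=> [i d] [j e] _ _.
  have xS : x ^+ (if d then - j else j)%R = if d then x ^- j else x ^+ j.
    by case: d; rewrite ?xN.
  have xC : x ^+ (if d && e then c else 0)%R = if d && e then x ^+ c else 1.
    by case: ifP; rewrite ?expg0.
  transitivity (x ^+ (i + (if d then - j else j)
                        + (if d && e then c else 0))%R
                * (if d (+) e then y else 1)) => //.
  rewrite xD xD xS xC /f.
  case: d {xS xC}; case: e; rewrite /= ?mulg1 -?mulgA //.
  - by rewrite -y2 [y * (_ * _)]mulgA yx -mulgA.
  - by rewrite yx.
have im_f : Morphism fM @* [set: T] = H.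
  apply/eqP; rewrite eqEsubset; apply/andP; split.
    apply/subsetP=> _ /morphimP[[i d] _ _ ->]; rewrite -defH /= /f /=.
    have [Hx Hy] : x \in <[x]> <*> <[y]> /\ y \in <[x]> <*> <[y]>.
      by rewrite !mem_gen // inE cycle_id ?orbT.
    by rewrite groupM ?groupX //; case: d.
  rewrite -defH join_subG !cycle_subG; apply/andP; split; apply/morphimP.
    exists ((inZp 1, false) : T); rewrite ?inE //= /f /= mulg1.
    by rewrite (expg_mod _ xm).
  by exists ((0%R, true) : T); rewrite ?inE //= /f /= mul1g.
by apply/homgP; exists (Morphism fM).
Qed.

End InvExt.

Fact dihedral_exists (n : nat) : 0 < n ->
  exists (gT : finGroupType) (G : {group gT}),
    is_dihedral n G /\ #|G| = (2 * n)%N.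
Proof.
case: n => // n _; pose c2 := addr0 (0%R : 'I_n.+1).
exists (inv_ext c2), [set: inv_ext c2]%G.
by split; [exact: inv_ext_Grp | exact: card_inv_ext].
Qed.

Fact dicyclic_exists (n : nat) : 0 < n ->
  exists (gT : finGroupType) (G : {group gT}),
    is_dicyclic n G /\ #|G| = (4 * n)%N.
Proof.
move=> n_gt0; have [m def_m] : exists m, (2 * n)%N = m.+1.
  by exists (2 * n).-1; rewrite prednK // muln_gt0.
have lt_nm : n < m.+1 by rewrite -def_m ltn_Pmull.
have c2 : (Ordinal lt_nm + Ordinal lt_nm = 0)%R.
  by apply/val_inj; rewrite /= addnn -mul2n def_m modnn.
exists (inv_ext c2), [set: inv_ext c2]%G; split.
  by rewrite /is_dicyclic def_m; apply: inv_ext_Grp.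
by rewrite card_inv_ext -def_m mulnA.
Qed.

(* Main.v *)
Require Import Defs.
From HB Require Import structures.
From mathcomp Require Import all_boot all_order all_algebra all_fingroup.
From mathcomp Require Import cyclic.

(* The edges preserve the abelian subgroup generated by a commuting pair, and
   together they realise the action of SL_2(Z) on commuting pairs. Every
   abelian subgroup of a dihedral or dicyclic group is cyclic or has at most 4
   elements. In the cyclic case Euclid's algorithm on exponents connects each
   generating pair to a pair (1, h); in the remaining case (the Klein
   four-group) all generating pairs are connected by inspection. So the
   components correspond to the abelian subgroups. *)

Set Implicit Arguments.
Unset Strict Implicit.
Unset Printing Implicit Defensive.

Local Open Scope group_scope.

(** * Counting components by a complete invariant *)

(** [n_comp] counts the roots lying in [A]. As [A] is closed, passing from a point to its root stays
    in [A] and keeps the value of [f]; on roots [f] is injective, because connected roots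
    coincide. *)
Lemma n_comp_card_image (T T' : finType) (e : rel T) (A : {pred T})
    (f : T -> T') :
    connect_sym e -> fingraph.closed e (mem A) ->
    {in A &, forall x y, connect e x y = (f x == f y)} ->
  n_comp e A = #|[set f x | x in A]|.
Proof.
move=> sym_e clA fE.
have rootA x : (fingraph.root e x \in A) = (x \in A).
  by rewrite -(closed_connect clA (connect_root e x)).
have -> : [set f x | x in A] = [set f x | x in [predI roots e & A]].
  apply/setP=> y; apply/imsetP/imsetP=> -[x].
    move=> Ax ->; exists (fingraph.root e x).
      by apply/andP; rewrite rootA; split; first exact: roots_root.
    by apply/eqP; rewrite -fE ?rootA ?connect_root.
  by case/andP=> _ Ax ->; exists x.
rewrite card_in_imset // => x y /andP[/eqP rx Ax] /andP[/eqP ry Ay] /eqP.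
by rewrite -fE // -(root_connect sym_e) rx ry => /eqP.
Qed.

(** * The subgroup generated by a pair, constant on components *)

Section CommutingPairs.
Variables (gT : finGroupType) (G : {group gT}).
Implicit Types (g h k x : gT) (u v : gT * gT) (H : {group gT}).

(** Bundled as a group, so that its values are elements of a finite type and can be matched with the
    members of [subgroups G]. *)
Definition pair_group u : {group gT} := (<[u.1]> <*> <[u.2]>)%G.

Local Notation "u ~~> v" := (connect (r1_edge G) u v) (at level 70).

Lemma mem_commuting_pairs g k :
  (g, k) \in commuting_pairs G = [&& g \in G, k \in G & g * k == k * g].
Proof.
rewrite !inE /= -andbA; do 2!congr (_ && _).
by apply/commgP/eqP => [/commute_sym|/esym].
Qed.

Lemma mem_pair_group1 g k : g \in pair_group (g, k).
Proof. by rewrite mem_gen // inE cycle_id. Qed.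

Lemma mem_pair_group2 g k : k \in pair_group (g, k).
Proof. by rewrite mem_gen // inE cycle_id orbT. Qed.

Lemma pair_group_sub g k H :
  (pair_group (g, k) \subset H) = (g \in H) && (k \in H).
Proof. by rewrite join_subG !cycle_subG. Qed.

Lemma pair_group_twist g k x :
  x \in <[g]> -> pair_group (g, k * x) = pair_group (g, k).
Proof.
move=> gx; apply/val_inj/eqP; rewrite /= eqEsubset !pair_group_sub.
have sub l : x \in pair_group (g, l).
  by apply: subsetP gx; rewrite cycle_subG mem_pair_group1.
rewrite !mem_pair_group1 groupM ?mem_pair_group2 ?sub //=.
by rewrite -(groupMr _ (sub _)) mem_pair_group2.
Qed.

Lemma pair_group_swap g k : pair_group (k, g^-1) = pair_group (g, k).
Proof. by apply/val_inj; rewrite /= cycleV joingC. Qed.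

(** A twist changes [k] by an element of [<[g]>]. On commuting pairs the conjugation in a swap is
    trivial, so a swap only exchanges the generators and inverts one of them. *)
Lemma pair_group_edge u v : r1_edge G u v -> pair_group u = pair_group v.
Proof.
have twist w z : twist_move w z -> pair_group w = pair_group z.
  case: w z => [g k] [h l] /andP[/= /eqP-> /lcosetP[x gx ->]].
  by rewrite pair_group_twist.
have swap w z :
    w \in commuting_pairs G -> swap_move w z -> pair_group w = pair_group z.
  case: w => [g k] Ggk /eqP->; have [/= -> _] := swap_move_commuting Ggk.
  by rewrite pair_group_swap.
case/and3P=> Gu Gv /or4P[] uv; first [exact: twist|exact/esym/twist|idtac].
  exact: swap.
exact/esym/swap.
Qed.

Lemma pair_group_connect u v : u ~~> v -> pair_group u = pair_group v.
Proof.
case/connectP=> p; elim: p u => [|w p IHp] u /=; first by move=> _ ->.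
by case/andP=> /pair_group_edge-> /IHp.
Qed.

Lemma connect_commuting u v :
  u ~~> v -> u \in commuting_pairs G -> v \in commuting_pairs G.
Proof. by move/(closed_connect (@r1_closed _ G)) => /= ->. Qed.

(** * Paths made of twists and swaps *)

Lemma connect_twist g k x :
  (g, k) \in commuting_pairs G -> x \in <[g]> -> (g, k) ~~> (g, k * x).
Proof.
move=> Ggk gx; apply: connect1; apply/and3P; split=> //; last first.
  by rewrite /twist_move /= eqxx mem_lcoset mulKg gx.
move: Ggk; rewrite !mem_commuting_pairs => /and3P[Gg Gk /eqP cgk].
rewrite Gg groupM // /=; last by apply: subsetP gx; rewrite cycle_subG.
apply/eqP; apply: commuteM => //; apply/cent1P.
by rewrite cent1C; apply: subsetP gx; rewrite cycle_subG cent1id.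
Qed.

Lemma connect_swap g k :
  (g, k) \in commuting_pairs G -> (g, k) ~~> (k, g^-1).
Proof.
move=> Ggk; have [def_v Gv] := swap_move_commuting Ggk.
by apply: connect1; rewrite /r1_edge Ggk Gv /swap_move /= def_v eqxx !orbT.
Qed.

Lemma commuting_cycle h g k : h \in G -> g \in <[h]> -> k \in <[h]> ->
  (g, k) \in commuting_pairs G.
Proof.
move=> Gh hg hk; rewrite mem_commuting_pairs.
have sG: <[h]> \subset G by rewrite cycle_subG.
rewrite !(subsetP sG) //=; apply/eqP.
by apply: (centsP (cycle_abelian h)).
Qed.

(** Strong induction on [i] for pairs [(h ^+ i, h ^+ j)]: a twist reduces [j] modulo [i], and a swap
    then moves the remainder to the first place, where it is smaller than [i]. *)
Lemma connect_cyclic_one g k :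
    (g, k) \in commuting_pairs G -> cyclic (pair_group (g, k)) ->
  exists h, (g, k) ~~> (1, h).
Proof.
rewrite mem_commuting_pairs => /and3P[Gg Gk _] /cyclicP[h defH].
have Gh : h \in G by rewrite -cycle_subG -defH pair_group_sub Gg.
have := mem_pair_group1 g k; have := mem_pair_group2 g k.
rewrite !defH => /cycleP[j ->] /cycleP[i ->].
elim/ltn_ind: i j => i IHi j {g k Gg Gk defH}.
have [->|i_gt0] := posnP i; first by exists (h ^+ j).
(* The swap produces the exponent [-i]; [#[h] * i - i] represents it as a natural number modulo
   [#[h]]. *)
have [l] := IHi _ (ltn_pmod j i_gt0) (#[h] * i - i).
have -> : h ^+ (#[h] * i - i) = h ^- i.
  apply: (mulIg (h ^+ i)); rewrite mulVg -expgD subnK; last exact: leq_pmull.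
  by rewrite expgM expg_order expg1n.
move=> con_l; exists l; apply: connect_trans con_l.
have Gij: (h ^+ i, h ^+ j) \in commuting_pairs G.
  by apply: commuting_cycle Gh _ _; rewrite mem_cycle.
have con : (h ^+ i, h ^+ j) ~~> (h ^+ i, h ^+ (j %% i)).
  have -> : h ^+ (j %% i) = h ^+ j * (h ^+ i) ^- (j %/ i).
    by rewrite {2}(divn_eq j i) addnC expgD mulnC expgM mulgK.
  by rewrite connect_twist // groupV mem_cycle.
exact: connect_trans con (connect_swap (connect_commuting con Gij)).
Qed.

(** The path is (1, h), (h, 1), (h, k), (k, h^-1), (k, 1), (1, k). Both twists are possible because
    each of [h] and [k] is a power of the other. *)
Lemma connect_one_generators h k :
  h \in G -> <[h]> = <[k]> -> (1, h) ~~> (1, k).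
Proof.
move=> Gh hk; have kh: k \in <[h]> by rewrite hk cycle_id.
have Gc := commuting_cycle Gh.
have swap1 g : g \in <[h]> -> (1, g) ~~> (g, 1).
  by move=> hg; rewrite -[X in (g, X)]invg1 connect_swap // Gc ?group1.
have step1 : (h, 1) ~~> (h, k).
  by rewrite -(mul1g k) connect_twist ?Gc ?cycle_id ?group1.
have step2 : (h, k) ~~> (k, h^-1) by rewrite connect_swap ?Gc ?cycle_id.
have step3 : (k, h^-1) ~~> (k, 1).
  rewrite -[X in _ ~~> (k, X)](mulVg h) connect_twist ?Gc ?groupV ?cycle_id //.
  by rewrite -hk cycle_id.
rewrite (connect_trans (swap1 h (cycle_id h))) // (connect_trans step1) //.
rewrite (connect_trans step2) // (connect_trans step3) //.
by rewrite r1_connect_sym swap1.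
Qed.

(** Any coincidence among the four listed elements would put [g] and [k] in a common cyclic
    subgroup. Hence they are distinct, and the bound 4 leaves room for no other element. *)
Lemma noncyclic_pair_group g k : ~~ cyclic (pair_group (g, k)) ->
    #|pair_group (g, k)| <= 4 ->
  pair_group (g, k) =i [:: 1; g; k; k * g].
Proof.
move=> ncH H_le4; set H := pair_group (g, k) in ncH H_le4 *.
have nH h : g \in <[h]> -> k \in <[h]> -> False.
  move=> hg hk; case/negP: ncH; apply: cyclicS (cycle_cyclic h).
  by rewrite pair_group_sub hg.
have [Hg Hk] : g \in H /\ k \in H by rewrite mem_pair_group1 mem_pair_group2.
have U : uniq [:: 1; g; k; k * g].
  have nt_g : g != 1.
    by apply/eqP=> g1; apply: (nH k); rewrite ?cycle_id ?g1.
  have nt_k : k != 1.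
    by apply/eqP=> k1; apply: (nH g); rewrite ?cycle_id ?k1.
  have neq_gk : g != k.
    by apply/eqP=> gk; apply: (nH g); rewrite -?gk cycle_id.
  have nt_kg : k * g != 1.
    rewrite -eq_invg_mul; apply/eqP=> kVg; apply: (nH k); rewrite ?cycle_id //.
    by rewrite -kVg groupV cycle_id.
  rewrite /= !inE !negb_or !(eq_sym 1) nt_g nt_k nt_kg neq_gk /=.
  rewrite andbT; apply/andP; split; apply/eqP=> eq_kg.
    by case/eqP: nt_k; apply: (mulIg g); rewrite mul1g.
  by case/eqP: nt_g; apply: (mulgI k); rewrite mulg1.
have sH : {subset [:: 1; g; k; k * g] <= enum H}.
  by move=> x; rewrite mem_enum !inE => /or4P[] /eqP->; rewrite ?groupM.
have /(_ _)[|_ eqH] := uniq_min_size U sH; first by rewrite -cardE.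
by move=> x; rewrite eqH mem_enum.
Qed.

(** The candidates for [h] are [g], already in first place, [k], reached by a swap, and [k * g],
    reached by a twist followed by a swap. *)
Lemma connect_noncyclic_first g k h :
    (g, k) \in commuting_pairs G -> ~~ cyclic (pair_group (g, k)) ->
    #|pair_group (g, k)| <= 4 -> h \in pair_group (g, k) -> h != 1 ->
  exists l, (g, k) ~~> (h, l).
Proof.
move=> Ggk ncH H_le4; rewrite noncyclic_pair_group // !inE.
case/or4P=> /eqP->; first by rewrite eqxx.
- by exists k.
- by exists g^-1; apply: connect_swap.
have con := connect_twist Ggk (cycle_id g).
have Ggkg := connect_commuting con Ggk.
by exists g^-1; apply: connect_trans con (connect_swap Ggkg).
Qed.

(** Once the first entries agree, the second entry [m] of the target is one of 1, [h], [l], [l * h].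
    The first two would make the group cyclic; the last two are at most one twist away. *)
Lemma connect_noncyclic u v :
    u \in commuting_pairs G -> pair_group u = pair_group v ->
    ~~ cyclic (pair_group u) -> #|pair_group u| <= 4 ->
  u ~~> v.
Proof.
case: u v => [g k] [h m] Ggk eqH ncH H_le4.
have nt_h : h != 1.
  apply: contraNneq ncH => h1; rewrite eqH h1 /= cycle1 joing1G.
  exact: cycle_cyclic.
have [l con] : exists l, (g, k) ~~> (h, l).
  by apply: connect_noncyclic_first; rewrite // eqH mem_pair_group1.
have Ghl := connect_commuting con Ggk.
have eqL : pair_group (h, m) = pair_group (h, l).
  by rewrite -eqH; apply: pair_group_connect.
apply: connect_trans con _.
have := mem_pair_group2 h m; rewrite eqL noncyclic_pair_group -?eqL -?eqH //.
have nc x : x \in <[h]> -> m <> x.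
  move=> hx def_m; case/negP: ncH; apply: cyclicS (cycle_cyclic h).
  by rewrite eqH pair_group_sub def_m hx cycle_id.
rewrite !inE => /or4P[] /eqP def_m.
- by case: (nc 1).
- by case: (nc h); rewrite ?cycle_id.
- by rewrite def_m.
by rewrite def_m connect_twist ?cycle_id.
Qed.

(** Both pairs reduce to a pair with first entry 1; invariance of [pair_group] forces the two second
    entries to generate the same cyclic group. *)
Lemma connect_cyclic u v :
    u \in commuting_pairs G -> v \in commuting_pairs G ->
    pair_group u = pair_group v -> cyclic (pair_group u) ->
  u ~~> v.
Proof.
case: u v => [g k] [g' k'] Gu Gv eqH cycH.
have [h con_h] := connect_cyclic_one Gu cycH.
have [|h' con_h'] := connect_cyclic_one Gv; first by rewrite -eqH.
have := pair_group_connect con_h'; rewrite -eqH (pair_group_connect con_h).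
move/(congr1 val); rewrite /= cycle1 !joing1G => eq_h.
have := connect_commuting con_h Gu; rewrite mem_commuting_pairs.
case/and3P=> _ Gh _; apply: connect_trans con_h _.
apply: connect_trans (connect_one_generators Gh eq_h) _.
by rewrite r1_connect_sym.
Qed.

(** * Abelian subgroups as groups generated by commuting pairs *)

Lemma abelian_pair_group u :
    u \in commuting_pairs G ->
  pair_group u \in subgroups G /\ abelian (pair_group u).
Proof.
case: u => g k; rewrite mem_commuting_pairs => /and3P[Gg Gk /eqP cgk].
rewrite inE pair_group_sub Gg Gk; split=> //=.
by rewrite abelianY !cycle_abelian /= cent_cycle cycle_subG; apply/cent1P.
Qed.

(** A cyclic [<[h]>] comes from (1, h). Otherwise take [g] nontrivial in [H] and [k] in [H] outside
    [<[g]>]: they generate at least 4 elements, hence all of [H]. *)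
Lemma pair_group_surj H :
    H \subset G -> abelian H -> cyclic H || (#|H| <= 4) ->
  exists2 u, u \in commuting_pairs G & H = pair_group u.
Proof.
move=> sHG abH; have [/cyclicP[h defH] _|ncH /= H_le4] := boolP (cyclic H).
  exists (1, h); last by apply/val_inj; rewrite /= cycle1 joing1G.
  rewrite mem_commuting_pairs group1 mul1g mulg1 eqxx andbT.
  by rewrite -cycle_subG -defH.
have [g Hg nt_g] : exists2 g, g \in H & g != 1.
  by apply/trivgPn; apply: contraNneq ncH => ->; apply: cyclic1.
have [|k Hk gk] := subsetPn (_ : ~~ (H \subset <[g]>)).
  by apply: contraNN ncH => sHg; apply: cyclicS sHg (cycle_cyclic g).
exists (g, k).
  rewrite mem_commuting_pairs !(subsetP sHG) //=.
  by apply/eqP; apply: (centsP abH).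
apply/esym/val_inj/eqP; rewrite /= eqEcard.
have -> : <[g]> <*> <[k]> \subset H by rewrite join_subG !cycle_subG Hg.
apply: leq_trans H_le4 _.
have pr : <[g]> \proper <[g]> <*> <[k]>.
  rewrite properE joing_subl; apply: contra gk => /subsetP; apply.
  exact: mem_pair_group2.
(* By Lagrange the order is [q] times that of [g], and both factors are at least 2. *)
have /dvdnP[q Eq] := cardSg (proper_sub pr).
have := proper_card pr; rewrite Eq -{1}[#|<[g]>|]mul1n ltn_pmul2r // => q_gt1.
by apply: (@leq_mul 2 2) => //; rewrite -[#|_|]/#[g] order_gt1.
Qed.

(** Here [pair_group] is a complete invariant of components, and its image on commuting pairs is
    exactly the set of abelian subgroups. *)
Lemma r1_abelian_le4 :
    (forall H, H \subset G -> abelian H -> cyclic H || (#|H| <= 4)) ->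
  r1 G = #|[set H in subgroups G | abelian H]|.
Proof.
move=> abP; rewrite /r1 (@n_comp_card_image _ _ _ _ pair_group).
- congr #|pred_of_set _|; apply/setP=> H; rewrite inE; apply/imsetP/andP.
    by case=> u Gu ->; apply: abelian_pair_group.
  by rewrite inE; case=> sHG abH; apply: pair_group_surj => //; apply: abP.
- exact: r1_connect_sym.
- exact: r1_closed.
move=> u v Gu Gv; apply/idP/eqP; first exact: pair_group_connect.
move=> eqH; have [cycH|ncH] := boolP (cyclic (pair_group u)).
  exact: connect_cyclic.
apply: connect_noncyclic => //; have [sHG abH] := abelian_pair_group Gu.
by rewrite inE in sHG; have := abP _ sHG abH; rewrite (negPf ncH).
Qed.

End CommutingPairs.

(** * Abelian subgroups of dihedral and dicyclic groups *)

(** If [H] has an element [y] outside [<[a]>], then [y] both centralises and inverts the part of [H]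
    inside [<[a]>]. That part is cyclic of exponent at most 2, so of order at most 2, and [H] is
    covered by two of its cosets. *)
Lemma inverted_cycle_abelian (gT : finGroupType) (a b : gT) (H : {group gT}) :
    b ^+ 2 \in <[a]> -> b * a * b^-1 = a^-1 ->
    H \subset <[a]> <*> <[b]> -> abelian H ->
  cyclic H || (#|H| <= 4).
Proof.
move=> b2 ab sHG abH.
have conjVb x : x ^ b^-1 = b * x * b^-1 by rewrite conjgE invgK mulgA.
have ba x : x \in <[a]> -> b * x * b^-1 = x^-1.
  by case/cycleP=> i ->; rewrite -conjVb conjXg conjVb ab expgVn.
have nab : <[b]> \subset 'N(<[a]>).
  rewrite cycle_subG -groupV inE; apply/subsetP=> _ /imsetP[x ax ->].
  by rewrite conjVb ba // groupV.
have [sHa|] := boolP (H \subset <[a]>).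
  by rewrite (cyclicS sHa) ?cycle_cyclic.
case/subsetPn=> y Hy a'y.
(* Since [b ^+ 2] lies in [<[a]>], only the parity of the power of [b] matters, and it is odd
   outside [<[a]>]. *)
have coset z : z \in H -> z \notin <[a]> -> z * b^-1 \in <[a]>.
  move/(subsetP sHG); rewrite norm_joinEr //.
  case/mulsgP=> x _ ax /cycleP[i ->] ->.
  rewrite -(odd_double_half i) addnC -mul2n expgD expgM.
  have ab2 : (b ^+ 2) ^+ i./2 \in <[a]> by rewrite groupX.
  case: (odd i); last by rewrite mulg1 groupM.
  by move=> _; rewrite expg1 mulgA mulgK groupM.
have Hay := coset y Hy a'y.
(* Such an [x] commutes with [y] and with [y * b^-1], hence with [b]; but [b] inverts it. *)
have sq1 x : x \in H -> x \in <[a]> -> x ^+ 2 = 1.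
  move=> Hx ax; suff bx : commute x b.
    by apply/eqP; rewrite expgS expg1 -eq_invg_mul -(ba x ax) -bx mulgK.
  have -> : b = (y * b^-1)^-1 * y by rewrite invMg invgK mulgKV.
  apply: commuteM; last exact: (centsP abH).
  by apply: (centsP (cycle_abelian a)); rewrite ?groupV.
set K := (H :&: <[a]>)%G.
have K_le2 : #|K| <= 2.
  have /cyclicP[x defK] : cyclic K.
    by rewrite (cyclicS (subsetIr _ _)) ?cycle_cyclic.
  have /setIP[Hx ax] : x \in K by rewrite defK cycle_id.
  by rewrite defK dvdn_leq // order_dvdn sq1.
have sHK : H \subset K :|: K :* y.
  apply/subsetP=> z Hz.
  rewrite in_setU mem_rcoset !in_setI Hz groupM ?groupV //=.
  have [//|a'z /=] := boolP (z \in <[a]>).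
  (* Multiplying [z * y^-1] by [y * b^-1], an element of [<[a]>], gives [z * b^-1], which [coset]
     places in [<[a]>]. *)
  by rewrite -(groupMr _ Hay) mulgA mulgKV coset.
apply/orP; right; apply: leq_trans (subset_leq_card sHK) _.
apply: leq_trans (leq_card_setU _ _) _.
by rewrite card_rcoset (leq_add K_le2 K_le2).
Qed.

Theorem corollary7 (n : nat) (hn : 0 < n) :
  (forall (gT : finGroupType) (G : {group gT}), is_dihedral n G ->
     r1 G = #|[set H in subgroups G | abelian H]|) /\
  (forall (gT : finGroupType) (G : {group gT}), is_dicyclic n G ->
     r1 G = #|[set H in subgroups G | abelian H]|).
Proof.
(* Each presentation supplies generators with [b] inverting [a]; the square of [b] is 1 in the
   dihedral case and a power of [a] in the dicyclic case. *)
split=> gT G /isoGrp_hom/existsP[[a b]] /= /eqP[defG _ b2 ab];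
  apply: r1_abelian_le4 => H; rewrite -defG;
  apply: inverted_cycle_abelian => //.
  by rewrite b2 group1.
by rewrite b2 mem_cycle.
Qed.
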